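(* Let $\mathbf{x}(s)$, $s\in I$, be a multiplicative biregular curve in $\mathbb{E}_*^3$ parametrized by multiplicative arc length, with $\kappa\neq0_*$. Let $\rho(s)=\|\mathbf{x}(s)\|_*$ be its multiplicative distance function and $\mathbf{x}^{\perp_*}$ its multiplicative normal component. If $\mathbf{x}$ is a multiplicative rectifying curve, then $\rho(s)$ is nonconstant and $\|\mathbf{x}^{\perp_*}(s)\|_*$ is constant on $I$. Conversely, if $\rho(s)$ is nonconstant and $\|\mathbf{x}^{\perp_*}(s)\|_*$ is constant on $I$, then $\mathbf{x}$ is a multiplicative rectifying curve.
   Context: Multiplicative arithmetic. $\mathbb{R}_*$ is the set of positive reals with the field operations $a+_*b=e^{\log a+\log b}$, $a-_*b=e^{\log a-\log b}$, $a\cdot_*b=e^{\log a\log b}$, $a/_*b=e^{\log a/\log b}$ ($b\ne1$); $0_*=1$, $1_*=e$; $>$ is the usual order. Also $a^{2_*}=e^{(\log a)^2}$ and $a^{\frac12_*}=e^{\sqrt{\log a}}$ (for $a\ge 1$). Multiplicative derivative. For $f:I\to\mathbb{R}_*$, $I\subset\mathbb{R}_*$ an interval, $f^*(s)=\lim_{h\to1}(f(s+_*h)-_*f(s))/_*h=e^{s(\log f(s))'}$, with $'$ the usual derivative. All functions are multiplicative differentiable to whatever order is needed. For vector-valued functions the derivative is taken componentwise. Multiplicative Euclidean space. $\mathbb{E}_*^3$ is $\mathbb{R}_*^3$ with $\mathbf{x}+_*\mathbf{y}=(x_iy_i)_i$, $a\cdot_*\mathbf{x}=(e^{\log a\log x_i})_i$,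 zero vector $\mathbf{0}_*=(1,1,1)$, inner product $\langle\mathbf{x},\mathbf{y}\rangle_*=e^{\sum_i\log x_i\log y_i}$, norm $\|\mathbf{x}\|_*=\langle\mathbf{x},\mathbf{x}\rangle_*^{\frac12_*}=e^{\sqrt{\sum_i(\log x_i)^2}}$. Cross product: $\mathbf{x}\times_*\mathbf{y}=(e^{\log x_2\log y_3-\log x_3\log y_2},e^{\log x_3\log y_1-\log x_1\log y_3},e^{\log x_1\log y_2-\log x_2\log y_1})$. Vectors are multiplicative collinear iff their cross product is $\mathbf{0}_*$. Subtraction of vectors and scalar division $\mathbf{x}/_*a$ are componentwise. Curves. $\mathbf{x}:I\to\mathbb{E}_*^3$ is parametrized by multiplicative arc length if $\|\mathbf{x}^*(s)\|_*=1_*$ for all $s$; it is multiplicative biregular if $\mathbf{x}^*(s)$ and $\mathbf{x}^{**}(s)$ are nowhere multiplicative collinear. The multiplicative Frenet frame of a biregular arc length parametrized curve is $\mathbf{t}=\mathbf{x}^*$, $\mathbf{n}=\mathbf{x}^{**}/_*\|\mathbf{x}^{**}\|_*$, $\mathbf{b}=\mathbf{t}\times_*\mathbf{n}$. The multiplicative curvature is $\kappa=\|\mathbf{x}^{**}\|_*$. The multiplicative normal component is $\mathbf{x}^{\perp_*}=\langle\mathbf{x},\mathbf{n}\rangle_*\cdot_*\mathbf{n}+_*\langle\mathbf{x},\mathbf{b}\rangle_*\cdot_*\mathbf{b}$, so that $\|\mathbf{x}^{\perp_*}\|_*=e^{\sqrt{(\log\langle\mathbf{x},\mathbf{n}\rangle_*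 )^2+(\log\langle\mathbf{x},\mathbf{b}\rangle_* )^2}}$. A multiplicative biregular curve $\mathbf{x}$ is a multiplicative rectifying curve if $\langle\mathbf{x}(s),\mathbf{n}(s)\rangle_*=0_*$ for every $s\in I$. *)

(* Defs.v *)
From HB Require Import structures.
From mathcomp Require Import all_boot all_order all_algebra.
From mathcomp Require Import all_classical all_reals all_analysis.

Set Implicit Arguments.
Unset Strict Implicit.
Unset Printing Implicit Defensive.

Import Order.TTheory GRing.Theory Num.Theory.
Import numFieldNormedType.Exports.

Local Open Scope classical_set_scope.
Local Open Scope ring_scope.

(* The multiplicative reals are modelled by the ambient real field: positivity *)
(* of the data is a hypothesis (see star_positive), and every operation below  *)
(* returns a positive real.                                                    *)

Section StarArithmetic.
Context {R : realType}.
Implicit Types a b : R.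

Definition star_zero : R := 1.
Definition star_one : R := expR 1.
Definition star_add a b : R := expR (ln a + ln b).
Definition star_sub a b : R := expR (ln a - ln b).
Definition star_mul a b : R := expR (ln a * ln b).
Definition star_div a b : R := expR (ln a / ln b).
Definition star_sqrt a : R := expR (Num.sqrt (ln a)).

End StarArithmetic.

Section StarSpace.
Context {R : realType}.
Implicit Types (a : R) (x y : 'rV[R]_3).

Definition star_vzero : 'rV[R]_3 := \row_i star_zero.
Definition star_vadd x y : 'rV[R]_3 := \row_i star_add (x 0 i) (y 0 i).
Definition star_vscale a x : 'rV[R]_3 := \row_i star_mul a (x 0 i).
Definition star_vdiv x a : 'rV[R]_3 := \row_i star_div (x 0 i) a.

Definition star_dot x y : R := expR (\sum_i ln (x 0 i) * ln (y 0 i)).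
Definition star_norm x : R := star_sqrt (star_dot x x).

(* The coordinates x_1, x_2, x_3 are x 0 0, x 0 1, x 0 2. *)
Definition star_cross x y : 'rV[R]_3 :=
  \row_(i < 3)
    [:: expR (ln (x 0 1) * ln (y 0 2) - ln (x 0 2) * ln (y 0 1));
        expR (ln (x 0 2) * ln (y 0 0) - ln (x 0 0) * ln (y 0 2));
        expR (ln (x 0 0) * ln (y 0 1) - ln (x 0 1) * ln (y 0 0))]`_i.

Definition star_collinear x y : Prop := star_cross x y = star_vzero.

End StarSpace.

Section StarDerivative.
Context {R : realType}.
Implicit Types (I : set R) (f : R -> R) (x : R -> 'rV[R]_3) (s : R).

Definition star_quotient f s (h : R) : R :=
  star_div (star_sub (f (star_add s h)) (f s)) h.

(* h tends to 1 through values h != 1 such that s +_* h stays in I, so that    *)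
(* the derivative is one-sided at an endpoint of I belonging to I.             *)
Definition star_increments I s : set_system R :=
  within (fun h => 0 < h /\ I (star_add s h)) (star_zero : R)^'.

(* The limit is required to be positive: a quotient tending to 0 in the        *)
(* ambient field diverges in the multiplicative reals.                         *)
Definition star_derivable I f s : Prop :=
  exists2 l : R, 0 < l & star_quotient f s h @[h --> star_increments I s] --> l.

Definition star_derive I f s : R :=
  lim (star_quotient f s h @[h --> star_increments I s]).

Fixpoint star_derivable_n I (n : nat) f : Prop :=
  if n is m.+1 then
    (forall s, I s -> star_derivable I f s) /\
    star_derivable_n I m (star_derive I f)
  else True.

Definition star_vderivable_n I (n : nat) x : Prop :=
  forall i : 'I_3, star_derivable_n I n (fun s => x s 0 i).

Definition star_vderive I x s : 'rV[R]_3 :=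
  \row_i star_derive I (fun t => x t 0 i) s.

End StarDerivative.

Section StarCurves.
Context {R : realType}.
Variables (I : set R) (x : R -> 'rV[R]_3).

Definition star_positive : Prop :=
  forall s, I s -> forall i : 'I_3, 0 < x s 0 i.

Definition star_tangent : R -> 'rV[R]_3 := star_vderive I x.

Definition star_acceleration : R -> 'rV[R]_3 :=
  star_vderive I (star_vderive I x).

Definition star_arclength : Prop :=
  forall s, I s -> star_norm (star_vderive I x s) = star_one.

Definition star_biregular : Prop :=
  forall s, I s -> ~ star_collinear (star_vderive I x s) (star_acceleration s).

Definition star_curvature (s : R) : R := star_norm (star_acceleration s).

Definition star_normal (s : R) : 'rV[R]_3 :=
  star_vdiv (star_acceleration s) (star_norm (star_acceleration s)).

Definition star_binormal (s : R) : 'rV[R]_3 :=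
  star_cross (star_tangent s) (star_normal s).

Definition star_distance (s : R) : R := star_norm (x s).

Definition star_normal_component (s : R) : 'rV[R]_3 :=
  star_vadd
    (star_vscale (star_dot (x s) (star_normal s)) (star_normal s))
    (star_vscale (star_dot (x s) (star_binormal s)) (star_binormal s)).

Definition star_rectifying : Prop :=
  forall s, I s -> star_dot (x s) (star_normal s) = star_zero.

End StarCurves.

Definition constant_on {R : realType} (I : set R) (f : R -> R) : Prop :=
  exists c : R, forall s, I s -> f s = c.

(* Main.v *)
(* With s = e^u, the logarithms Y of the coordinates satisfy Y' = log x^*, so   *)
(* the statement concerns a unit speed curve Y in Euclidean space, and          *)
(* p = <Y, Y'>, g = <Y, Y''> = kappa <Y, n>. As |Y^perp|^2 = |Y|^2 - p^2, the   *)
(* relations (|Y|^2)' = 2 p and p' = 1 + g give (|Y^perp|^2)' = -2 p g.         *)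
(* If g = 0 then |Y^perp| is constant and |Y| is not, since otherwise p = 0 and *)
(* p' = 1. Conversely p g = 0 forces g = -1 near any point where g is nonzero,  *)
(* so by continuity g is identically 0 or identically -1; in the second case    *)
(* p = 0 and |Y| is constant.                                                   *)
Require Import Defs.
From HB Require Import structures.
From mathcomp Require Import all_boot all_order all_algebra.
From mathcomp Require Import all_classical all_reals all_analysis.
From mathcomp Require Import ring lra.

Set Implicit Arguments.
Unset Strict Implicit.
Unset Printing Implicit Defensive.

Import Order.TTheory GRing.Theory Num.Theory.
Import numFieldNormedType.Exports.

Local Open Scope classical_set_scope.
Local Open Scope ring_scope.

(** For the resulting unit speed curve, the Gram identity [orthonormal_normal_component] expresses
    the squared length of the normal component as the squared distance minus the square of the
    tangential component p, so the frame enters only through g, the product of Y with the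
    acceleration.

    The forward direction is [sqdistance_nonconstant] together with [sqnormal_constant]. For the
    converse, p g = 0 at every point; [acceleration_component_dichotomy] restricts g to two values,
    and [acceleration_component_eq0] excludes the nonzero one by the intermediate value theorem and
    the nonconstancy of the distance. [rectifying_log_curve] assembles both directions in
    logarithmic form. *)

(** * Derivatives relative to an interval, one-sided at its endpoints *)

Section WithinDerivative.
Context {R : realType}.
Implicit Types (J : set R) (F G : R -> R).

Definition has_derivative_within J F (u l : R) : Prop :=
  (F v - F u) / (v - u) @[v --> within J u^'] --> l.

Definition nontrivial_interval J : Prop :=
  is_interval J /\ exists a b : R, [/\ J a, J b & a < b].

(** Every point of a nontrivial interval is an accumulation point of it; this is what makes relative
    derivatives unique. *)
Lemma within_dnbhs_proper J u :
  nontrivial_interval J -> J u -> ProperFilter (within J u^').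
Proof.
move=> [Jint [a [b [Ja Jb ab]]]] Ju; apply: Build_ProperFilter_ex => P.
have [w Jw wu] : exists2 w, J w & w != u.
  have [bu|bu] := eqVneq b u; last by exists b.
  by exists a => //; rewrite -bu lt_eqF.
rewrite /within /= => /nbhs_ballP [e /= e0 He].
have wu0 : 0 < `|w - u| by rewrite normr_gt0 subr_eq0.
(* Moving from [u] towards [w] by the fraction [t] stays between them, hence in [J], and at distance
   at most [e / 2] from [u]. *)
pose t := Num.min 1 (e / 2 / `|w - u|).
have t0 : 0 < t by rewrite lt_min ltr01 /= !divr_gt0.
have t1 : t <= 1 by rewrite ge_min lexx.
have te : t * `|w - u| < e.
  rewrite (@le_lt_trans _ _ (e / 2)) //; last by lra.
  by rewrite -ler_pdivlMr // ge_min lexx orbT.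
exists (u + t * (w - u)); apply: He.
- rewrite /ball /= opprD addrA subrr sub0r normrN normrM (gtr0_norm t0) //.
- by rewrite -[X in _ != X]addr0 (inj_eq (addrI u)) mulf_neq0 ?subr_eq0 // gt_eqF.
- case: (ltgtP u w) => uw.
  + by apply: (Jint u w) => //; apply/andP; split; nra.
  + by apply: (Jint w u) => //; apply/andP; split; nra.
  + by rewrite uw eqxx in wu.
Qed.

Lemma has_derivative_within_unique J F u l l' :
  nontrivial_interval J -> J u ->
  has_derivative_within J F u l -> has_derivative_within J F u l' -> l = l'.
Proof.
move=> HJ Ju; have PF := within_dnbhs_proper HJ Ju.
exact: (@cvg_unique R (@Rhausdorff R)).
Qed.

Lemma eq_cvg_within_dnbhs J u (f g : R -> R) (l : R) :
  (forall v, J v -> v != u -> f v = g v) ->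
  f v @[v --> within J u^'] --> l -> g v @[v --> within J u^'] --> l.
Proof.
move=> fg fl P /fl Pf.
have Pf' : \forall v \near u^', J v -> P (f v) by exact: Pf.
suff : \forall v \near u^', J v -> P (g v) by [].
by apply: filterS2 Pf' (nbhs_dnbhs_neq u) => v Pv vu Jv; rewrite -fg //; exact: Pv.
Qed.

Lemma has_derivative_within_ext J F G u l :
  J u -> (forall v, J v -> F v = G v) ->
  has_derivative_within J F u l -> has_derivative_within J G u l.
Proof.
by move=> Ju FG; apply: eq_cvg_within_dnbhs => v Jv _; rewrite !FG.
Qed.

Lemma has_derivative_within_cst J c u : has_derivative_within J (cst c) u 0.
Proof.
rewrite /has_derivative_within.
under eq_fun do rewrite /cst subrr mul0r; exact: cvg_cst.
Qed.

Lemma has_derivative_withinD J F G u l m :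
  has_derivative_within J F u l -> has_derivative_within J G u m ->
  has_derivative_within J (fun v => F v + G v) u (l + m).
Proof.
move=> dF dG; rewrite /has_derivative_within.
under eq_fun do rewrite opprD addrACA mulrDl; exact: cvgD.
Qed.

Lemma has_derivative_within_cvg J F u l :
  has_derivative_within J F u l -> F v @[v --> within J u^'] --> F u.
Proof.
move=> dF.
have vu : v - u @[v --> within J u^'] --> 0.
  rewrite -(subrr u); apply: cvgB; last exact: cvg_cst.
  by apply: cvg_within_filter; exact: cvg_within.
have lim : (F v - F u) / (v - u) * (v - u) + F u @[v --> within J u^'] --> F u.
  rewrite -[X in _ --> X]add0r -(mulr0 l).
  by apply: cvgD; [exact: cvgM | exact: cvg_cst].
apply: eq_cvg_within_dnbhs lim => v _ vNu.
by rewrite divfK ?subrK // subr_eq0.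
Qed.

Lemma has_derivative_withinM J F G u l m :
  has_derivative_within J F u l -> has_derivative_within J G u m ->
  has_derivative_within J (fun v => F v * G v) u (l * G u + F u * m).
Proof.
move=> dF dG; rewrite /has_derivative_within.
have -> : (fun v => (F v * G v - F u * G u) / (v - u)) =
  (fun v => (F v - F u) / (v - u) * G v + F u * ((G v - G u) / (v - u))).
  by apply/funext => v; ring.
apply: cvgD; first by apply: cvgM => //; exact: has_derivative_within_cvg dG.
by apply: cvgM => //; exact: cvg_cst.
Qed.

Lemma has_derivative_within_sum J n (F F' : 'I_n -> R -> R) u :
  (forall i, has_derivative_within J (F i) u (F' i u)) ->
  has_derivative_within J (fun v => \sum_i F i v) u (\sum_i F' i u).
Proof.
elim: n F F' => [|n IH] F F' dF.
  under eq_fun do rewrite big_ord0; rewrite big_ord0.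
  exact: has_derivative_within_cst.
under eq_fun do rewrite big_ord_recr /=; rewrite big_ord_recr /=.
pose w := widen_ord (leqnSn n).
by apply: has_derivative_withinD => //; apply: (IH (F \o w) (F' \o w)) => i; exact: dF.
Qed.

Lemma has_derivative_within_continuous J F F' :
  (forall u, J u -> has_derivative_within J F u (F' u)) ->
  {within J, continuous F}.
Proof.
move=> dF; apply/subspace_continuousP => u Ju.
have := has_derivative_within_cvg (dF u Ju).
move=> /cvgrPdist_lt FF; apply/cvgrPdist_lt => e e0.
have := FF e e0; rewrite /within /= => H.
apply/nbhs_ballP; case/nbhs_ballP : H => d /= d0 Hd; exists d => // v /= duv Jv.
have [->|vu] := eqVneq v u; first by rewrite subrr normr0.
exact: Hd.
Qed.

(** At an interior point the restriction to [J] disappears near [u]; this gives access to the mean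
    value theorem. *)
Lemma has_derivative_within_is_derive J F u l a b :
  `]a, b[%classic `<=` J -> u \in `]a, b[ ->
  has_derivative_within J F u l -> is_derive u 1 F l.
Proof.
move=> abJ uab dF.
have Jnbhs : \forall v \near u, J v.
  apply: filterS abJ _; exact: near_in_itvoo.
have shift : h + u @[h --> 0^'] --> within J u^'.
  have cont : {for 0, continuous (fun h : R => h + u)}.
    by apply: (@cvgD _ R); [exact: cvg_id | exact: cvg_cst].
  have shiftN := @continuous_injective_withinNx _ _ _ _ cont.
  rewrite add0r in shiftN.
  move=> P wP; apply: shiftN; first by move=> h /eqP; rewrite -subr_eq0 addrK => /eqP.
  by apply: filterS2 (wP : u^' _) (nbhs_dnbhs Jnbhs) => v; exact.
have lim : h^-1 *: (F (h *: 1 + u) - F u) @[h --> 0^'] --> l.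
  have -> : (fun h => h^-1 *: (F (h *: 1 + u) - F u)) =
      (fun v => (F v - F u) / (v - u)) \o (fun h => h + u).
    by apply/funext => h; rewrite /= addrK /GRing.scale /= mulr1 mulrC.
  exact: cvg_comp shift dF.
apply: DeriveDef; first by apply/cvg_ex; exists l.
by apply: cvg_lim.
Qed.

Lemma derivative_within_zero_cst J F :
  is_interval J -> (forall u, J u -> has_derivative_within J F u 0) ->
  forall u v, J u -> J v -> F u = F v.
Proof.
move=> Jint dF.
suff main u v : J u -> J v -> u < v -> F u = F v.
  move=> u v Ju Jv; case: (ltgtP u v) => [|vu|->//]; first exact: main.
  exact/esym/main.
move=> Ju Jv uv.
have uvJ w : u <= w <= v -> J w by exact: Jint.
(* The mean value theorem asks for two-sided derivatives only on the open segment, and for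
   continuity on the closed one, so endpoints of [J] cause no trouble. *)
have [c _ Fvu] : exists2 c : R, c \in `]u, v[ & F v - F u = 0 * (v - u).
  apply: (@MVT R F (cst 0)) => //.
  - move=> w wuv; apply: (@has_derivative_within_is_derive J F w 0 u v) => //.
      by move=> z /=; rewrite in_itv /= => /andP[uz zv]; apply: uvJ; rewrite !ltW.
    apply: dF; apply: uvJ; move: wuv; rewrite in_itv /= => /andP[uz zv].
    by rewrite !ltW.
  - apply: (@continuous_subspaceW _ _ _ J).
      by move=> w /=; rewrite in_itv /=; exact: uvJ.
    exact: (has_derivative_within_continuous (F' := cst 0)).
by apply/esym/eqP; rewrite -subr_eq0 Fvu mul0r.
Qed.

End WithinDerivative.

(** * Unit speed curves in Euclidean space of dimension [n] *)

Section EuclideanCurve.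
Context {R : realType} (J : set R) (n : nat) (Y T A B : 'I_n -> R -> R).

Definition fdot (F G : 'I_n -> R -> R) (u : R) : R := \sum_i F i u * G i u.

Hypothesis J_nontrivial : nontrivial_interval J.
Hypothesis Y_der :
  forall u, J u -> forall i, has_derivative_within J (Y i) u (T i u).
Hypothesis T_der :
  forall u, J u -> forall i, has_derivative_within J (T i) u (A i u).
Hypothesis A_der :
  forall u, J u -> forall i, has_derivative_within J (A i) u (B i u).
Hypothesis T_unit : forall u, J u -> fdot T T u = 1.

Lemma fdot_has_derivative F F' G G' u :
  (forall i, has_derivative_within J (F i) u (F' i u)) ->
  (forall i, has_derivative_within J (G i) u (G' i u)) ->
  has_derivative_within J (fdot F G) u (fdot F' G u + fdot F G' u).
Proof.
move=> dF dG; rewrite /fdot -big_split /=.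
apply: (@has_derivative_within_sum _ _ _ (fun i v => F i v * G i v)
  (fun i v => F' i v * G i v + F i v * G' i v)) => i.
exact: has_derivative_withinM.
Qed.

Lemma fdotC F G u : fdot F G u = fdot G F u.
Proof. by apply: eq_bigr => i _; rewrite mulrC. Qed.

Lemma derivative_of_constant F u l c :
  J u -> (forall v, J v -> F v = c) -> has_derivative_within J F u l -> l = 0.
Proof.
move=> Ju Fc dF; apply: (has_derivative_within_unique J_nontrivial Ju dF).
apply: (has_derivative_within_ext Ju) (has_derivative_within_cst J c u) => v Jv.
by rewrite Fc.
Qed.

Lemma tangent_orthogonal_acceleration u : J u -> fdot T A u = 0.
Proof.
move=> Ju; have /(derivative_of_constant Ju T_unit) :=
  fdot_has_derivative (T_der Ju) (T_der Ju).
by rewrite fdotC; lra.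
Qed.

Lemma sqdistance_has_derivative u :
  J u -> has_derivative_within J (fdot Y Y) u (2 * fdot Y T u).
Proof.
move=> Ju; have := fdot_has_derivative (Y_der Ju) (Y_der Ju).
by rewrite (fdotC T Y) mulrDl mul1r.
Qed.

Lemma tangential_has_derivative u :
  J u -> has_derivative_within J (fdot Y T) u (1 + fdot Y A u).
Proof.
by move=> Ju; have := fdot_has_derivative (Y_der Ju) (T_der Ju); rewrite T_unit.
Qed.

Lemma sqnormal_has_derivative u : J u ->
  has_derivative_within J (fun v => fdot Y Y v - fdot Y T v ^+ 2) u
    (- (2 * fdot Y T u * fdot Y A u)).
Proof.
move=> Ju.
have dp := tangential_has_derivative Ju.
have dm := has_derivative_withinM (has_derivative_within_cst J (-1) u)
  (has_derivative_withinM dp dp).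
have := has_derivative_withinD (sqdistance_has_derivative Ju) dm.
rewrite /cst (_ : _ + _ = - (2 * fdot Y T u * fdot Y A u)); last by ring.
by apply: (has_derivative_within_ext Ju) => v _; ring.
Qed.

Lemma sqdistance_nonconstant :
  (forall u, J u -> fdot Y A u = 0) -> ~ exists c, forall u, J u -> fdot Y Y u = c.
Proof.
move=> g0 [c wc].
have p0 u : J u -> fdot Y T u = 0.
  by move=> Ju; have := derivative_of_constant Ju wc (sqdistance_has_derivative Ju); lra.
have [_ [a [b [Ja _ _]]]] := J_nontrivial.
have := derivative_of_constant Ja p0 (tangential_has_derivative Ja).
by rewrite g0 //; lra.
Qed.

Lemma sqnormal_constant :
  (forall u, J u -> fdot Y A u = 0) ->
  exists c, forall u, J u -> fdot Y Y u - fdot Y T u ^+ 2 = c.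
Proof.
move=> g0; have [Jint [a [_ [Ja _ _]]]] := J_nontrivial.
exists (fdot Y Y a - fdot Y T a ^+ 2) => u Ju.
apply: (derivative_within_zero_cst
  (F := fun v => fdot Y Y v - fdot Y T v ^+ 2) Jint) => // v Jv.
have := sqnormal_has_derivative Jv; by rewrite g0 // mulr0 oppr0.
Qed.

(** If g does not vanish at [u], it does not vanish nearby, by continuity, so p vanishes near [u]
    and 0 = p' = 1 + g there. The third derivative [B] supplies the continuity of g. *)
Lemma acceleration_component_dichotomy u :
  (forall v, J v -> fdot Y T v * fdot Y A v = 0) -> J u ->
  fdot Y A u = 0 \/ fdot Y A u = -1.
Proof.
move=> pg Ju; have [->|gu] := eqVneq (fdot Y A u) 0; [by left|right].
have dg := fdot_has_derivative (Y_der Ju) (A_der Ju).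
have g_neq0 : \forall v \near within J u^', fdot Y A v != 0.
  by apply: (cvgr_neq0 _ _ gu); exact: has_derivative_within_cvg dg.
have p_eq0 v : J v -> fdot Y A v != 0 -> fdot Y T v = 0.
  by move=> Jv /negPf gv; have /eqP := pg v Jv; rewrite mulf_eq0 gv orbF => /eqP.
have dp0 : has_derivative_within J (fdot Y T) u 0.
  move=> P /(cvg_cst (F := within J u^') (0 : R)) P0.
  suff : \forall v \near u^', J v -> P ((fdot Y T v - fdot Y T u) / (v - u)) by [].
  apply: filterS2 (P0 : \forall v \near u^', J v -> P 0)
    (g_neq0 : \forall v \near u^', J v -> fdot Y A v != 0) => v P0v gv Jv.
  by rewrite !p_eq0 ?gv // subrr mul0r; exact: P0v.
have := has_derivative_within_unique J_nontrivial Ju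
  (tangential_has_derivative Ju) dp0.
by lra.
Qed.

Lemma acceleration_component_eq0 c :
  (~ exists d, forall u, J u -> fdot Y Y u = d) ->
  (forall u, J u -> fdot Y Y u - fdot Y T u ^+ 2 = c) ->
  forall u, J u -> fdot Y A u = 0.
Proof.
move=> w_nonconst vc.
have pg v : J v -> fdot Y T v * fdot Y A v = 0.
  by move=> Jv; have := derivative_of_constant Jv vc (sqnormal_has_derivative Jv); lra.
have dich v := @acceleration_component_dichotomy v pg.
have [Jint _] := J_nontrivial.
have no_jump a b : J a -> J b -> a <= b -> fdot Y A a = fdot Y A b.
  move=> Ja Jb ab; apply: contrapT => gab.
  have abJ v : a <= v <= b -> J v by exact: Jint.
  have cont : {within `[a, b], continuous (fdot Y A)}.
    apply: (@continuous_subspaceW _ _ _ J).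
      by move=> v /=; rewrite in_itv /=; exact: abJ.
    apply: has_derivative_within_continuous => v Jv.
    exact: fdot_has_derivative (Y_der Jv) (A_der Jv).
  (* Any value strictly between -1 and 0 would do: if g took both values, it would also take -1/2,
     against the dichotomy. *)
  have mid : Num.min (fdot Y A a) (fdot Y A b) <= - 2^-1 <=
             Num.max (fdot Y A a) (fdot Y A b).
    move: gab; case: (dich a Ja) => ->; case: (dich b Jb) => -> // _;
      by rewrite ge_min le_max; apply/andP; split; apply/orP;
         first [left; lra | right; lra].
  have [d] := IVT ab cont mid.
  rewrite in_itv /= => /abJ Jd gd; have := dich d Jd; rewrite gd; lra.
move=> u Ju; have [//|gu] := dich u Ju; case: w_nonconst.
(* With g equal to -1 throughout, p g = 0 forces p = 0, so the squared distance has zero derivative,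
   against its nonconstancy. *)
have g1 v : J v -> fdot Y A v = -1.
  by move=> Jv; have [uv|/ltW vu] := leP u v; rewrite -gu;
    [apply/esym|]; apply: no_jump.
exists (fdot Y Y u) => v Jv.
apply: (derivative_within_zero_cst Jint) => // w Jw.
have := sqdistance_has_derivative Jw.
have -> // : 2 * fdot Y T w = 0.
by have := pg w Jw; rewrite g1 //; lra.
Qed.

End EuclideanCurve.

(** The vectors t, n, b = t x n are orthonormal, so this is Pythagoras for y. Both sides reduce to
    the Gram entries of y, t, n before the orthonormality equations are used. *)
Lemma orthonormal_normal_component (R : comRingType)
    (t0 t1 t2 n0 n1 n2 y0 y1 y2 : R)
    (b0 := t1 * n2 - t2 * n1) (b1 := t2 * n0 - t0 * n2) (b2 := t0 * n1 - t1 * n0)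
    (yn := y0 * n0 + y1 * n1 + y2 * n2) (yb := y0 * b0 + y1 * b1 + y2 * b2) :
  t0 * t0 + t1 * t1 + t2 * t2 = 1 ->
  t0 * n0 + t1 * n1 + t2 * n2 = 0 ->
  n0 * n0 + n1 * n1 + n2 * n2 = 1 ->
  (yn * n0 + yb * b0) * (yn * n0 + yb * b0) +
  (yn * n1 + yb * b1) * (yn * n1 + yb * b1) +
  (yn * n2 + yb * b2) * (yn * n2 + yb * b2) =
  y0 * y0 + y1 * y1 + y2 * y2 - (y0 * t0 + y1 * t1 + y2 * t2) ^+ 2.
Proof.
set tt := (X in X = 1 -> _); set tn := (X in _ -> X = 0 -> _).
set nn := (X in _ -> _ -> X = 1 -> _) => tt1 tn0 nn1.
set yy := (X in _ = X - _); set yt := (X in _ = _ - X ^+ 2).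
set lhs := LHS.
(* The mixed term drops because n is orthogonal to b, and the last factor is the squared length of b
   by Lagrange's identity. *)
have -> : lhs = yn ^+ 2 * nn + yb ^+ 2 * (tt * nn - tn ^+ 2).
  by rewrite /lhs /b0 /b1 /b2 /nn /tt /tn; ring.
(* The squared triple product is the Gram determinant of y, t, n. *)
have -> : yb ^+ 2 = yy * (tt * nn - tn ^+ 2) - yt * (yt * nn - tn * yn)
                    + yn * (yt * tn - tt * yn).
  by rewrite /yb /b0 /b1 /b2 /yy /yt /yn /nn /tt /tn; ring.
by rewrite tt1 tn0 nn1; ring.
Qed.

(** * Logarithmic form of the multiplicative derivative, inner product and frame *)

Section Logarithms.
Context {R : realType}.
Implicit Types (I : set R) (f : R -> R) (a t y : 'rV[R]_3).

Lemma log_domain_nontrivial I :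
  is_interval I -> (forall s, I s -> 0 < s) ->
  (exists a b : R, [/\ I a, I b & a < b]) -> nontrivial_interval (expR @^-1` I).
Proof.
move=> Iint Ipos [a [b [Ia Ib ab]]]; split.
  move=> u v /= Iu Iv w /andP[uw wv]; apply: (Iint _ _ Iu Iv).
  by rewrite !ler_expR uw.
exists (ln a), (ln b); rewrite /= !lnK ?posrE ?Ipos //; split => //.
by rewrite ltr_ln ?posrE ?Ipos.
Qed.

(** This is the substitution h = e^(v - log s), under which s +_* h = e^v: increments keeping s +_*
    h in [I] correspond to points v of the logarithmic domain. *)
Lemma cvg_star_increments I s : 0 < s ->
  expR (v - ln s) @[v --> within (expR @^-1` I) (ln s)^'] --> star_increments I s.
Proof.
move=> s0.
have cont : {for ln s, continuous (fun v : R => expR (v - ln s))}.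
  apply: (@continuous_comp _ _ _ (fun v => v - ln s) expR).
    by apply: (@cvgB _ R); [exact: cvg_id | exact: cvg_cst].
  exact: continuous_expR.
have inj v : expR (v - ln s) = expR (ln s - ln s) -> v = ln s.
  by move=> /expR_inj /addIr.
have lim := continuous_injective_withinNx cont inj.
rewrite subrr expR0 in lim.
move=> P /lim PP.
have {}PP : \forall v \near (ln s)^',
    0 < expR (v - ln s) /\ I (star_add s (expR (v - ln s))) -> P (expR (v - ln s)).
  exact: PP.
suff : \forall v \near (ln s)^', I (expR v) -> P (expR (v - ln s)) by [].
apply: filterS PP => v /= Pv Iv.
apply: Pv; split; first exact: expR_gt0.
by rewrite /star_add expRK addrC subrK.
Qed.

(* The definition of the multiplicative derivative reads f^* (e^u) = e^(F' u)   *)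
(* for F u = log (f (e^u)).                                                     *)
Lemma star_derive_log I f s :
  nontrivial_interval (expR @^-1` I) -> (forall s, I s -> 0 < s) -> I s ->
  star_derivable I f s ->
  has_derivative_within (expR @^-1` I) (fun u => ln (f (expR u))) (ln s)
    (ln (star_derive I f s)).
Proof.
move=> Jnt Ipos Is [l l0 fl].
have s0 := Ipos s Is.
have lims := @cvg_star_increments I s s0.
have Js : (expR @^-1` I) (ln s) by rewrite /= lnK.
have PF := within_dnbhs_proper Jnt Js.
(* [star_derive] is a [lim], so identifying it with [l] requires a proper filter; properness is
   transported along [lims]. *)
have Plim : ProperFilter (star_increments I s).
  by apply: Build_ProperFilter => /lims; exact: (@filter_not_empty _ _ PF).
have -> : star_derive I f s = l by exact: (cvg_lim (@Rhausdorff R)).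
have lnf := cvg_comp _ _ (cvg_comp _ _ lims fl) (continuous_ln l0).
rewrite /has_derivative_within; apply: eq_cvg_within_dnbhs lnf => v _ _.
rewrite /= /star_quotient /star_div /star_sub /star_add !expRK.
by rewrite (addrC (ln s)) subrK lnK.
Qed.

Definition ldot t y : R := \sum_i ln (t 0 i) * ln (y 0 i).

Lemma star_normE y : star_norm y = expR (Num.sqrt (ldot y y)).
Proof. by rewrite /star_norm /star_sqrt expRK. Qed.

Lemma sum_ord3 (F : 'I_3 -> R) : \sum_i F i = F 0 + F 1 + F 2.
Proof.
by rewrite !big_ord_recl big_ord0 addr0 addrA; congr (F _ + F _ + F _); apply/val_inj.
Qed.

Lemma ldot_ge0 y : 0 <= ldot y y.
Proof. by apply: sumr_ge0 => i _; rewrite -expr2 sqr_ge0. Qed.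

Lemma ldotC t y : ldot t y = ldot y t.
Proof. by apply: eq_bigr => i _; rewrite mulrC. Qed.

Definition unit_normal a : 'rV[R]_3 := star_vdiv a (star_norm a).

Definition normal_part t n y : 'rV[R]_3 :=
  star_vadd (star_vscale (star_dot y n) n)
            (star_vscale (star_dot y (star_cross t n)) (star_cross t n)).

(** The convention that division by 0 gives 0 makes this hold even when [ldot a a] is 0. *)
Lemma ldot_unit_normal y a :
  ldot y (unit_normal a) = ldot y a / Num.sqrt (ldot a a).
Proof.
rewrite /unit_normal star_normE /ldot mulr_suml; apply: eq_bigr => i _.
by rewrite mxE /star_div !expRK mulrA.
Qed.

Lemma ldot_unit_normal_self a :
  ldot a a != 0 -> ldot (unit_normal a) (unit_normal a) = 1.
Proof.
move=> aa; have sqrt0 : Num.sqrt (ldot a a) != 0.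
  by rewrite sqrtr_eq0 -ltNge lt_def aa ldot_ge0.
rewrite ldot_unit_normal ldotC ldot_unit_normal.
by rewrite -{1}(sqr_sqrtr (ldot_ge0 a)) expr2 mulfK // divff.
Qed.

Lemma ln_star_cross t y :
  [/\ ln (star_cross t y 0 0) = ln (t 0 1) * ln (y 0 2) - ln (t 0 2) * ln (y 0 1),
      ln (star_cross t y 0 1) = ln (t 0 2) * ln (y 0 0) - ln (t 0 0) * ln (y 0 2) &
      ln (star_cross t y 0 2) = ln (t 0 0) * ln (y 0 1) - ln (t 0 1) * ln (y 0 0)].
Proof. by split; rewrite mxE /= expRK. Qed.

Lemma ldot_normal_component t n y (N := normal_part t n y) :
  ldot t t = 1 -> ldot t n = 0 -> ldot n n = 1 ->
  ldot N N = ldot y y - ldot y t ^+ 2.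
Proof.
rewrite {}/N /normal_part; have [] := ln_star_cross t n.
move: (star_cross t n) => b b0 b1 b2 tt tn nn.
have lnN i : ln (star_vadd (star_vscale (star_dot y n) n)
                           (star_vscale (star_dot y b) b) 0 i) =
    ldot y n * ln (n 0 i) + ldot y b * ln (b 0 i).
  by rewrite !mxE /star_add /star_mul !expRK.
move: tt tn nn.
rewrite [LHS in _ -> _ -> _ -> LHS = _]
  (eq_bigr _ (fun i _ => congr2 *%R (lnN i) (lnN i))).
rewrite /ldot !sum_ord3 b0 b1 b2.
exact: orthonormal_normal_component.
Qed.

End Logarithms.

(** * The equivalence in logarithmic form and its transfer to the multiplicative curve *)

Lemma rectifying_log_curve (R : realType) (J : set R) (y t a b : R -> 'rV[R]_3)
    (N := fun u => normal_part (t u) (unit_normal (a u)) (y u)) :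
  nontrivial_interval J ->
  (forall u, J u -> forall i,
     has_derivative_within J (fun v => ln (y v 0 i)) u (ln (t u 0 i))) ->
  (forall u, J u -> forall i,
     has_derivative_within J (fun v => ln (t v 0 i)) u (ln (a u 0 i))) ->
  (forall u, J u -> forall i,
     has_derivative_within J (fun v => ln (a v 0 i)) u (ln (b u 0 i))) ->
  (forall u, J u -> ldot (t u) (t u) = 1) ->
  (forall u, J u -> ldot (a u) (a u) != 0) ->
  (forall u, J u -> ldot (y u) (unit_normal (a u)) = 0) <->
  ~ (exists c, forall u, J u -> ldot (y u) (y u) = c) /\
  (exists c, forall u, J u -> ldot (N u) (N u) = c).
Proof.
move=> Jnt y_der t_der a_der tt aa.
pose L (z : R -> 'rV[R]_3) (i : 'I_3) u := ln (z u 0 i).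
have ta u : J u -> ldot (t u) (a u) = 0.
  exact: (tangent_orthogonal_acceleration (T := L t) (A := L a) Jnt t_der tt).
have NN u : J u -> ldot (N u) (N u) = ldot (y u) (y u) - ldot (y u) (t u) ^+ 2.
  move=> Ju; apply: ldot_normal_component; first exact: tt.
    by rewrite ldot_unit_normal ta // mul0r.
  exact/ldot_unit_normal_self/aa.
(* The two products differ by the nonzero factor |a|, so the rectifying condition is exactly g =
   0. *)
have ynE : (forall u, J u -> ldot (y u) (unit_normal (a u)) = 0) <->
           (forall u, J u -> ldot (y u) (a u) = 0).
  split=> yn u Ju; last by rewrite ldot_unit_normal yn // mul0r.
  have := yn u Ju; rewrite ldot_unit_normal => /eqP.
  rewrite mulf_eq0 invr_eq0 sqrtr_eq0 => /orP[/eqP //|].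
  by rewrite leNgt lt_def aa // ldot_ge0.
rewrite ynE; split=> [g0|[dist_nonconst [c NNc]]].
  split; first exact: (sqdistance_nonconstant (Y := L y) (T := L t) (A := L a)).
  have [c vc] := sqnormal_constant (Y := L y) (T := L t) (A := L a)
    Jnt y_der t_der tt g0.
  by exists c => u Ju; rewrite NN //; exact: vc.
apply: (acceleration_component_eq0 (Y := L y) (T := L t) (A := L a) (B := L b)
  Jnt y_der t_der a_der tt (c := c) dist_nonconst) => u Ju.
by rewrite -(NNc u Ju) NN.
Qed.

Lemma constant_star_norm (R : realType) (I : set R) (z : R -> 'rV[R]_3) :
  (forall s, I s -> 0 < s) ->
  constant_on I (fun s => star_norm (z s)) <->
  exists c, forall u, (expR @^-1` I) u -> ldot (z (expR u)) (z (expR u)) = c.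
Proof.
move=> I_pos; split=> [[c zc]|[c zc]].
  exists (ln c ^+ 2) => u Iu.
  by rewrite -(zc _ Iu) star_normE expRK sqr_sqrtr ?ldot_ge0.
exists (expR (Num.sqrt c)) => s Is.
have s0 : s \is Num.pos by rewrite posrE I_pos.
by rewrite star_normE -(zc (ln s)) /= lnK.
Qed.

Lemma star_dot_eq_zero (R : realType) (y z : 'rV[R]_3) :
  star_dot y z = star_zero <-> ldot y z = 0.
Proof.
split=> [|yz]; first by rewrite -[star_zero]expR0 => /expR_inj.
by rewrite /star_dot -/(ldot y z) yz expR0.
Qed.

Theorem proposition4p4 (R : realType) (I : set R) (x : R -> 'rV[R]_3)
    (I_interval : is_interval I)
    (I_nondegenerate : exists a b : R, [/\ I a, I b & a < b])
    (I_pos : forall s : R, I s -> 0 < s)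
    (x_pos : star_positive I x)
    (x_diff : star_vderivable_n I 3 x)
    (x_biregular : star_biregular I x)
    (x_arclength : star_arclength I x)
    (x_curvature : forall s : R, I s -> star_curvature I x s <> star_zero) :
  (star_rectifying I x ->
     ~ constant_on I (star_distance x) /\
     constant_on I (fun s => star_norm (star_normal_component I x s))) /\
  (~ constant_on I (star_distance x) /\
   constant_on I (fun s => star_norm (star_normal_component I x s)) ->
     star_rectifying I x).
Proof.
pose J := expR @^-1` I.
have Jnt : nontrivial_interval J by exact: log_domain_nontrivial.
have der f : (forall s, I s -> star_derivable I f s) -> forall u, J u ->
    has_derivative_within J (fun u => ln (f (expR u))) u
      (ln (star_derive I f (expR u))).
  move=> df u Ju; have := @star_derive_log _ I f (expR u) Jnt I_pos Ju (df _ Ju).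
  by rewrite expRK.
have vderE (z : R -> 'rV[R]_3) i :
    (fun s => star_vderive I z s 0 i) = star_derive I (fun s => z s 0 i).
  by apply/funext => s; rewrite mxE.
have vder (z : R -> 'rV[R]_3) u :
    (forall i s, I s -> star_derivable I (fun s => z s 0 i) s) ->
    J u -> forall i, has_derivative_within J (fun v => ln (z (expR v) 0 i)) u
      (ln (star_vderive I z (expR u) 0 i)).
  move=> dz Ju i; rewrite [star_vderive _ _ _ _ _]mxE.
  exact: (der _ (dz i) u Ju).
pose a := star_acceleration I x.
have [] := @rectifying_log_curve R J (x \o expR) (star_vderive I x \o expR)
  (a \o expR) (star_vderive I a \o expR) Jnt.
- move=> u; apply: vder => i; exact: (x_diff i).1.
- move=> u; apply: vder => i; rewrite vderE; exact: (x_diff i).2.1.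
- move=> u; apply: vder => i; rewrite /a /star_acceleration vderE vderE.
  exact: (x_diff i).2.2.1.
- move=> u Ju; have := x_arclength (expR u) Ju.
  rewrite star_normE => /expR_inj sqrt1.
  by rewrite -[LHS]sqr_sqrtr ?ldot_ge0 // [Num.sqrt _]sqrt1 expr1n.
(* Since 0_* = 1 = e^0, curvature different from 0_* says that the logarithmic acceleration has
   nonzero length. *)
- move=> u Ju; apply/eqP => aa0; apply: (x_curvature (expR u) Ju).
  by rewrite /star_curvature star_normE [ldot _ _]aa0 sqrtr0 expR0.
have rectE : star_rectifying I x <->
    forall u, J u -> ldot (x (expR u)) (unit_normal (a (expR u))) = 0.
  split=> [rect u Ju|rect s Is]; first exact/star_dot_eq_zero/(rect _ Ju).
  apply/star_dot_eq_zero; have sE : expR (ln s) = s by rewrite lnK ?posrE ?I_pos.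
  by have := rect (ln s); rewrite /J /= sE; exact.
have [distI distE] := constant_star_norm x I_pos.
have [normI normE] := constant_star_norm
  (fun s => normal_part (star_vderive I x s) (unit_normal (a s)) (x s)) I_pos.
move=> fwd bwd; split=> [/rectE rect|[dist_nonconst norm_const]].
  have [dist_nonconst norm_const] := fwd rect.
  split; first by move=> /distI.
  exact: (normE norm_const).
apply/rectE/bwd; split; first by move=> /distE.
exact: (normI norm_const).
Qed.
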